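(* Let $m,n\ge 1$ be integers. The number of directed Hamiltonian cycles in the complete $(m+1)$-partite graph $K_{n,n,\dots,n}$ ($m+1$ parts, each of size $n$) equals $$(-1)^{nm}\,n!^{\,m}\,(n-1)!\,m!\sum_{k=n}^{nm}(-1)^k\binom{k-1}{n-1}B_{k,m}\left(\left\{\binom{n-1}{i-1}\right\}_{i=1}^{k-m+1}\right).$$
   Context: $B_{k,m}(x_1,\dots,x_{k-m+1})$ denotes the partial (exponential) Bell polynomial, defined by $\frac{1}{m!}\left(\sum_{j\ge1}x_j\frac{t^j}{j!}\right)^m=\sum_{k\ge m}B_{k,m}(x_1,\dots,x_{k-m+1})\frac{t^k}{k!}$, with $B_{k,m}=0$ for $k<m$; in the formula it is evaluated at $x_i=\binom{n-1}{i-1}$. The number of directed Hamiltonian cycles in a graph $G$ with at least two vertices is the number of cyclic permutations $\sigma$ of $V(G)$ (a single cycle on all vertices) with $v$ and $\sigma(v)$ adjacent for every vertex $v$; in particular $K_r$ has $(r-1)!$ of them for $r\ge2$, and $K_2$ has one. *)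

(* Defs.v *)
From mathcomp Require Import all_boot all_order all_algebra all_fingroup.

Set Implicit Arguments.
Unset Strict Implicit.
Unset Printing Implicit Defensive.

Import GRing.Theory.
Local Open Scope ring_scope.

(* Formal power series over Q, as coefficient sequences. *)
Definition fps_one : nat -> rat := fun k => (k == 0)%N%:R.

Definition fps_mul (f g : nat -> rat) : nat -> rat :=
  fun k => \sum_(i < k.+1) f i * g (k - i)%N.

Definition fps_exp (f : nat -> rat) (m : nat) : nat -> rat :=
  iter m (fps_mul f) fps_one.

(* \sum_(j >= 1) x_j t^j / j!; the value x 0 is never used. *)
Definition egf (x : nat -> rat) : nat -> rat :=
  fun j => if (j == 0)%N then 0 else x j / j`!%:R.

(* B_{k,m}(x_1, x_2, ...), read off as k! times the coefficient of t^k in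
   egf(x)^m / m!.  It depends only on x_1, ..., x_{k-m+1}, and it is 0 for
   k < m because egf(x) has no constant term. *)
Definition bell_poly (k m : nat) (x : nat -> rat) : rat :=
  k`!%:R * (m`!%:R^-1 * fps_exp (egf x) m k).

Definition cyclic_perm (T : finType) (s : {perm T}) : bool :=
  porbits s == [set [set: T]].

(* Only meaningful for a symmetric, irreflexive e and 1 < #|T|. *)
Definition directed_hamiltonian_cycles (T : finType) (e : rel T)
  : {set {perm T}} :=
  [set s : {perm T} | cyclic_perm s & [forall v, e v (s v)]].

(* The complete r-partite graph with r parts of size n: the vertex (i, a) is
   the a-th vertex of part i. *)
Definition complete_multipartite (r n : nat) : rel ('I_r * 'I_n) :=
  fun u v => u.1 != v.1.
Arguments complete_multipartite : clear implicits.

(* Main.v *)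
(** Fix a vertex [v] of part 0 and cut each directed Hamiltonian cycle there: the
cycles become the orderings of the other vertices that give a path from [v] back
to [v].  The number of orderings of a set of vertices closing up to such a path
from a vertex of part [l] depends only on [l] and on the numbers [a_i] of vertices
available in each part; divided by the product of the [a_i!], it counts words in
the parts, without equal neighbours, and splitting off the first letter gives a
recurrence that determines it.

The solution is found by inclusion-exclusion on runs: with
[L_a = sum_j (-1)^(a-j) C(a-1,j-1) t^j/j!] ([L_0 = 1]) and the linear form
[Phi_b : t^k |-> k! C(k,b)] (the number of ways to order [k] blocks and to insert
[b] letters 0, pairwise non-adjacent and none at the end), the count is
[Phi_b(Q')] for [l = 0] and [Phi_b(L_(a_l + 1)' Q / L_(a_l))] for [l <> 0], where
[b = a_0] and [Q] is the product of the [L_(a_i)] over [i <> 0].  The recurrence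
follows from [L_(a+1)' = L_a - L_a'], the product rule for [Q'] and
[Phi_b(Q) = Phi_b(Q') + Phi_(b-1)(Q')].  For the whole graph the count is
[Phi_(n-1)((L_n^m)')], and the coefficients of [L_n^m] are Bell polynomials up to
sign. *)

From HB Require Import structures.
Require Import Defs.
From mathcomp Require Import all_boot all_order all_algebra all_fingroup.
From mathcomp Require Import ring.

Set Implicit Arguments.
Unset Strict Implicit.
Unset Printing Implicit Defensive.

Import GRing.Theory.
Local Open Scope ring_scope.

(** * Run polynomials and the gap form *)

Definition run_coef (a j : nat) : rat :=
  match a, j with
  | 0, 0 => 1
  | a'.+1, j'.+1 => (-1) ^+ (a' + j') * 'C(a', j')%:R / j`!%:R
  | _, _ => 0
  end.

(* [j!] times the coefficient of [t^j] in [run_poly a] is the signed number of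
   compositions of [a] into [j] parts. *)
Definition run_poly (a : nat) : {poly rat} := \poly_(j < a.+1) run_coef a j.

Definition gap_form (b : nat) (p : {poly rat}) : rat :=
  \sum_(k < size p) p`_k * (k`! * 'C(k, b))%:R.

Lemma factr_neq0 k : k`!%:R != 0 :> rat.
Proof. by rewrite Num.Theory.pnatr_eq0 -lt0n fact_gt0. Qed.

Lemma coef_run_poly a j : (run_poly a)`_j = run_coef a j.
Proof.
rewrite coef_poly; case: ltnP => //.
by case: a j => [|a] [|j] //= lt_aj; rewrite bin_small // mulr0 mul0r.
Qed.

Lemma run_poly0 : run_poly 0 = 1.
Proof. by apply/polyP => -[|j]; rewrite coef_run_poly coef1. Qed.

(** Once the factorials cancel, this is Pascal's rule for the binomials in [run_coef], with signs;
    [a = 0] and the constant coefficient are separate because [run_coef] is piecewise there. *)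
Lemma deriv_run_polyS a :
  (run_poly a.+1)^`() = run_poly a - (run_poly a)^`().
Proof.
apply/polyP => j; rewrite coefB !coef_deriv !coef_run_poly /=.
have scale k (c : rat) : c / k.+1`!%:R *+ k.+1 = c / k`!%:R.
  rewrite factS natrM -mulr_natr invfM mulrA mulrAC -(mulrA c) mulVf.
    by rewrite mulr1.
  by rewrite Num.Theory.pnatr_eq0.
rewrite scale; case: a => [|a] /=.
  by case: j => [|j]; rewrite ?divr1 ?mul0rn ?subr0 ?mulr1 ?mulr0 ?mul0r.
rewrite scale; case: j => [|j] /=.
  by rewrite !bin0 !addn0 exprS; ring.
rewrite binS natrD addSn addnS !exprS; ring.
Qed.

Lemma gap_form_widen b N (p : {poly rat}) :
  (size p <= N)%N -> gap_form b p = \sum_(k < N) p`_k * (k`! * 'C(k, b))%:R.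
Proof.
move=> le_pN; rewrite /gap_form (big_ord_widen N (fun k => p`_k * (k`! * 'C(k, b))%:R)) //.
rewrite big_mkcond; apply: eq_bigr => k _.
by case: ltnP => // /(nth_default 0) ->; rewrite mul0r.
Qed.

Lemma gap_form_is_scalar b : scalar (gap_form b).
Proof.
move=> c p q; set N := maxn (size p) (size q).
have le_p : (size p <= N)%N by apply: leq_maxl.
have le_q : (size q <= N)%N by apply: leq_maxr.
have le_pq : (size (c *: p + q)%R <= N)%N.
  rewrite (leq_trans (size_polyD _ _)) // geq_max le_q andbT.
  exact: leq_trans (size_scale_leq _ _) le_p.
rewrite (gap_form_widen _ le_p) (gap_form_widen _ le_q) (gap_form_widen _ le_pq).
rewrite mulr_sumr -big_split; apply: eq_bigr => k _.
by rewrite coefD coefZ mulrDl -mulrA.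
Qed.

HB.instance Definition _ b :=
  GRing.isLinear.Build rat {poly rat} rat *%R (gap_form b) (gap_form_is_scalar b).

(** The factor [k.+1] from differentiation completes [k]![to]k.+1[!], so only the binomial remembers
    the shift of index. Comparing ['C(k, b)] with ['C(k.+1, b)] then yields the next two lemmas. *)
Lemma gap_form_deriv b N (p : {poly rat}) : (size p <= N.+1)%N ->
  gap_form b p^`() = \sum_(k < N) p`_k.+1 * (k.+1`! * 'C(k, b))%:R.
Proof.
move=> le_pN; have le_dN : (size p^`()%R <= N)%N.
  have [->|p_n0] := eqVneq p 0; first by rewrite derivC size_poly0.
  by rewrite -ltnS (leq_trans (lt_size_deriv p_n0)).
rewrite (gap_form_widen _ le_dN); apply: eq_bigr => k _; rewrite coef_deriv.
by rewrite -(mulr_natr _ k.+1) -mulrA -natrM factS mulnA.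
Qed.

Lemma gap_formS b (p : {poly rat}) : gap_form b.+1 p = gap_form b.+1 p^`() + gap_form b p^`().
Proof.
rewrite !(@gap_form_deriv _ (size p)) // (@gap_form_widen _ (size p).+1) //.
rewrite big_ord_recl bin0n muln0 mulr0 add0r -big_split; apply: eq_bigr => k _.
by rewrite binS mulnDr natrD mulrDr.
Qed.

Lemma gap_form0 (p : {poly rat}) : p`_0 = 0 -> gap_form 0 p = gap_form 0 p^`().
Proof.
move=> p0; rewrite (@gap_form_deriv _ (size p)) //.
rewrite (@gap_form_widen _ (size p).+1) // big_ord_recl p0 mul0r add0r.
by apply: eq_bigr => k _; rewrite !bin0.
Qed.

Lemma deriv_prod_seq (R : comNzRingType) (I : eqType) (r : seq I) (F : I -> {poly R}) :
  uniq r ->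
  (\prod_(i <- r) F i)^`() = \sum_(i <- r) (F i)^`() * \prod_(j <- r | j != i) F j.
Proof.
elim: r => [|x r IHr] /=; first by rewrite !big_nil derivC.
case/andP => x_notin_r /IHr{}IHr; rewrite !big_cons derivM IHr eqxx; congr (_ + _).
  congr (_ * _); rewrite big_seq [RHS]big_seq_cond; apply: eq_bigl => j.
  by case: eqVneq => [->|]; rewrite ?andbT // (negPf x_notin_r).
rewrite mulr_sumr [LHS]big_seq [RHS]big_seq; apply: eq_bigr => i i_in_r.
rewrite big_cons; case: eqVneq => [xi|_]; last by rewrite mulrCA.
by rewrite xi i_in_r in x_notin_r.
Qed.

Lemma deriv_prod (R : comNzRingType) (I : finType) (P : pred I) (F : I -> {poly R}) :
  (\prod_(i | P i) F i)^`()
  = \sum_(i | P i) (F i)^`() * \prod_(j | P j && (j != i)) F j.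
Proof.
rewrite -big_filter deriv_prod_seq ?filter_uniq ?index_enum_uniq // big_filter.
by apply: eq_bigr => i _; rewrite big_filter_cond.
Qed.

(** * Word counts and their recurrence *)

Definition decr m (a : 'I_m.+1 -> nat) (l : 'I_m.+1) : 'I_m.+1 -> nat :=
  fun i => (a i - (i == l))%N.

(* The number of words with [a i] letters [i], without equal neighbours, not
   starting with [l] and not ending with [ord0]; the empty word is excluded
   when [l = ord0]. *)
Definition word_count m (a : 'I_m.+1 -> nat) (l : 'I_m.+1) : rat :=
  if l == ord0 then gap_form (a ord0) (\prod_(i | i != ord0) run_poly (a i))^`()
  else gap_form (a ord0)
         ((run_poly (a l).+1)^`() * \prod_(i | (i != ord0) && (i != l)) run_poly (a i)).

(** The empty word stands for a single edge from part [l] to part 0, which exists only between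
    different parts. *)
Lemma word_count0 m (a : 'I_m.+1 -> nat) l :
  (forall i, a i = 0%N) -> word_count a l = (l != ord0)%:R.
Proof.
move=> a0; have prod1 P : \prod_(i | P i) run_poly (a i) = 1.
  by apply: big1 => i _; rewrite a0 run_poly0.
rewrite /word_count !prod1 !a0 derivC deriv_run_polyS run_poly0 derivC subr0 mulr1.
case: eqVneq => _; first by rewrite linear0.
by rewrite /gap_form size_poly1 big_ord1 coef1 mulr1.
Qed.

(** For [l != ord0] the decrement cancels the [.+1] in [word_count], leaving the summand of index
    [l] in the product rule. *)
Lemma word_count_decr m (a : 'I_m.+1 -> nat) l : (0 < a l)%N ->
  word_count (decr a l) l
  = if l == ord0
    then gap_form (a ord0).-1 (\prod_(i | i != ord0) run_poly (a i))^`()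
    else gap_form (a ord0)
         ((run_poly (a l))^`() * \prod_(i | (i != ord0) && (i != l)) run_poly (a i)).
Proof.
move=> al_gt0; rewrite /word_count /decr eqxx subn1 prednK //.
case: eqVneq => [->|l_n0]; first rewrite subn1; last rewrite subn0.
  by congr (gap_form _ _^`()); apply: eq_bigr => i /negPf ->; rewrite subn0.
by congr (gap_form _ (_ * _)); apply: eq_bigr => i /andP[_ /negPf ->]; rewrite subn0.
Qed.

Lemma word_count_rec m (a : 'I_m.+1 -> nat) l : (exists i, 0 < a i)%N ->
  word_count a l
  = \sum_(i | (i != l) && (0 < a i)%N) word_count (decr a i) i.
Proof.
case=> i0 ai0; set q := \prod_(i | i != ord0) run_poly (a i).
pose D i := gap_form (a ord0)
   ((run_poly (a i))^`() * \prod_(j | (j != ord0) && (j != i)) run_poly (a j)).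
have sumD : gap_form (a ord0) q^`() = \sum_(i | i != ord0) D i.
  by rewrite deriv_prod linear_sum.
have D0 i : a i = 0%N -> D i = 0.
  by rewrite /D => ->; rewrite run_poly0 derivC mul0r linear0.
have rec i : (0 < a i)%N -> i != ord0 -> word_count (decr a i) i = D i.
  by move=> ai i_n0; rewrite word_count_decr // (negPf i_n0).
have dropD (P : pred 'I_m.+1) : {in P, forall i, i != ord0} ->
  \sum_(i | P i) D i = \sum_(i | P i && (0 < a i)%N) word_count (decr a i) i.
  move=> Pn0; rewrite big_mkcondr; apply: eq_bigr => i Pi.
  by case: posnP => [/D0//|ai]; rewrite rec // Pn0.
have [->|l_n0] := eqVneq l ord0.
  by rewrite /word_count eqxx sumD dropD.
(* The last term counts the words that start with the letter 0. If there is no such letter, some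
   other part is nonempty, so [q] has no constant term and [gap_form0] applies. *)
have gapq : gap_form (a ord0) q
  = gap_form (a ord0) q^`() + (if (0 < a ord0)%N then word_count (decr a ord0) ord0 else 0).
  case: posnP => [a0|a0_gt0]; last first.
    by rewrite word_count_decr // eqxx -{1}(prednK a0_gt0) gap_formS prednK.
  rewrite a0 addr0 gap_form0 //.
  have i0n0 : i0 != ord0 by apply: contraTneq ai0 => ->; rewrite a0.
  rewrite /q (bigD1 i0) //= coefM big_ord1 coef_run_poly.
  by case: (a i0) ai0 => // k _; rewrite mul0r.
(* The subtracted term is [D l]: it removes from the product-rule sum the words that start with
   [l]. *)
rewrite [LHS]/word_count (negPf l_n0) deriv_run_polyS mulrBl linearB /=.
have <- : q = run_poly (a l) * \prod_(i | (i != ord0) && (i != l)) run_poly (a i).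
  by rewrite /q (bigD1 l).
rewrite gapq sumD (bigD1 l) //= -/(D l) addrAC [D l + _]addrC addrK addrC.
rewrite dropD; last by move=> i /andP[].
rewrite big_mkcond [RHS]big_mkcond (bigD1 ord0) // [RHS](bigD1 ord0) //=.
rewrite add0r eq_sym l_n0; congr (_ + _); apply: eq_bigr => i ->.
by [].
Qed.
Lemma eq_word_count m (a b : 'I_m.+1 -> nat) l :
  a =1 b -> word_count a l = word_count b l.
Proof.
move=> eq_ab; rewrite /word_count !eq_ab.
by case: eqVneq => _; congr (gap_form _ _);
  [congr (_^`()) | congr (_ * _)]; apply: eq_bigr => i _; rewrite eq_ab.
Qed.

(** * From words to orderings of vertices *)

Lemma prod_fact_decr m (a : 'I_m.+1 -> nat) l : (0 < a l)%N ->
  (a l * \prod_i (decr a l i)`! = \prod_i (a i)`!)%N.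
Proof.
move=> al_gt0; rewrite (bigD1 l) //= [RHS](bigD1 l) //= mulnA /decr eqxx subn1.
rewrite -{1}(prednK al_gt0) -factS prednK //; congr (_ * _)%N.
by apply: eq_bigr => i /negPf ->; rewrite subn0.
Qed.

Lemma count_path_permutations (T : eqType) (e : rel T) (v w : T) (s : seq T) :
  uniq s -> (0 < size s)%N ->
  count (fun t => path e v (rcons t w)) (permutations s)
  = (\sum_(x <- s | e v x)
      count (fun t => path e x (rcons t w)) (permutations (rem x s)))%N.
Proof.
move=> Us s_gt0; rewrite (seq.permP (permutationsE s_gt0)) count_flatten undup_id //.
rewrite -map_comp sumnE big_map [RHS]big_mkcond; apply: eq_bigr => x _ /=.
rewrite count_map; case: ifP => evx; last first.
  by rewrite -(count_pred0 (permutations (rem x s))); apply: eq_count => t /=; rewrite evx.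
by apply: eq_count => t /=; rewrite evx.
Qed.

Lemma count_multipartite_paths m (T : eqType) (c : T -> 'I_m.+1) (w : T) :
  c w = ord0 -> forall (s : seq T) (v : T), uniq s ->
  let a i := count (fun x => c x == i) s in
  (count (fun t => path (fun x y => c x != c y) v (rcons t w)) (permutations s))%:R
  = (\prod_i (a i)`!)%:R * word_count a (c v).
Proof.
move=> cw s; have [k] := ubnP (size s); elim: k s => // k IHk s.
rewrite ltnS => le_sk v Us a.
have [s0|s_gt0] := posnP (size s).
  have -> : s = [::] by apply: size0nil.
  rewrite word_count0; last by move=> i; rewrite /a (size0nil s0).
  rewrite big1 ?mul1r; last by move=> i _; rewrite /a (size0nil s0).
  by rewrite /= cw andbT addn0.
have step x : x \in s ->
  (count (fun t => path (fun y z => c y != c z) x (rcons t w)) (permutations (rem x s)))%:R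
  = (\prod_i (decr a (c x) i)`!)%:R * word_count (decr a (c x)) (c x) :> rat.
  move=> x_s; have aE : (fun i => count (fun y => c y == i) (rem x s)) =1 decr a (c x).
    by move=> i; rewrite count_rem x_s /decr [c x == i]eq_sym.
  rewrite IHk ?rem_uniq //; last by rewrite size_rem // prednK.
  rewrite (eq_word_count _ aE); congr (_%:R * _).
  by apply: eq_bigr => i _; congr _`!; apply: aE.
rewrite count_path_permutations // natr_sum big_seq_cond.
under eq_bigr => x /andP[x_s _] do rewrite step //.
rewrite -big_seq_cond word_count_rec; last first.
  have x0_s : nth v s 0 \in s by rewrite mem_nth.
  by exists (c (nth v s 0)); rewrite -has_count; apply/hasP; exists (nth v s 0).
(* Group the possible first vertices by part: the [a i] vertices of part [i] contribute equally, and
   the factor [a i] restores the product of factorials. *)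
rewrite (partition_big c (fun i => i != c v)) /=; last by move=> x; rewrite eq_sym.
rewrite mulr_sumr [RHS]big_mkcondr; apply: eq_bigr => i i_cv.
rewrite (eq_bigl (fun x => c x == i)); last first.
  by move=> x; case: (eqVneq (c x) i) => [->|]; rewrite ?andbF // andbT eq_sym.
rewrite (eq_bigr (fun=> (\prod_j (decr a i j)`!)%:R * word_count (decr a i) i)); last first.
  by move=> x /eqP ->.
rewrite big_const_seq iter_addr addr0 -/(a i) -(mulr_natl _ (a i)) mulrA -natrM.
case: posnP => [->|ai_gt0]; first by rewrite mul0n mul0r.
by rewrite prod_fact_decr.
Qed.

(** * Coefficients as Bell polynomials *)

Lemma coef_run_poly_exp n m k : (0 < n)%N ->
  (run_poly n ^+ m)`_k
  = (-1) ^+ (n * m + k) * fps_exp (egf (fun i => 'C(n.-1, i.-1)%:R)) m k.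
Proof.
move=> n_gt0; elim: m k => [|m IHm] k.
  rewrite expr0 coef1 muln0 /= /fps_one; case: k => [|k]; first by rewrite mul1r.
  by rewrite mulr0.
rewrite exprS coefM /= /fps_mul mulr_sumr; apply: eq_bigr => i _.
(* At [i = 0] both sides vanish, since [n] is positive. *)
have -> : (run_poly n)`_i = (-1) ^+ (n + i) * egf (fun i => 'C(n.-1, i.-1)%:R) i.
  rewrite coef_run_poly; case: n n_gt0 {IHm} => // n _.
  case: (val i) => [|j]; first by rewrite /egf /= mulr0.
  by rewrite /egf /= addSn addnS exprS exprS mulrA mulrNN !mul1r -mulrA.
rewrite IHm mulrACA -exprD mulnS; congr (_ ^+ _ * _).
by rewrite addnACA [(_ + (k - i))%N]subnKC // -ltnS.
Qed.

Lemma gap_form_deriv_run_poly_exp m n : (0 < m)%N -> (0 < n)%N ->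
  gap_form n.-1 (run_poly n ^+ m)^`()
  = (-1) ^+ (n * m) * m`!%:R
    * \sum_(n <= k < (n * m).+1)
        (-1) ^+ k * 'C(k.-1, n.-1)%:R
        * bell_poly k m (fun i => 'C(n.-1, i.-1)%:R).
Proof.
move=> m_gt0; case: n => // n _.
have sz : (size (run_poly n.+1 ^+ m)%R <= (n.+1 * m).+1)%N.
  apply: leq_trans (size_poly_exp_leq _ _) _; rewrite ltnS leq_mul //.
  by rewrite -subn1 leq_subLR add1n size_poly.
rewrite (gap_form_deriv _ sz) mulr_sumr.
rewrite -(big_mkord xpredT (fun k => (run_poly n.+1 ^+ m)`_k.+1 * (k.+1`! * 'C(k, n))%:R)).
(* Here [n] is one less than the part size. The terms with [k < n] vanish, and the shift to [k.+1]
   makes the sum start at the part size. *)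
rewrite (@big_cat_nat _ _ _ n) //=; last by rewrite ltnW // leq_pmulr.
rewrite big_nat_cond big1 ?add0r; last first.
  by move=> k /andP[/andP[_ k_n] _]; rewrite bin_small // muln0 mulr0.
rewrite big_add1; apply: eq_bigr => k _.
rewrite coef_run_poly_exp // /bell_poly exprD natrM /=.
rewrite mulrCA; field.
exact: factr_neq0.
Qed.

(** * Cutting Hamiltonian cycles at a vertex *)

Lemma perm_rem_enum (T : finType) (v : T) (t : seq T) :
  perm_eq t (rem v (enum T)) = perm_eq (v :: t) (enum T).
Proof.
have /permPr -> : perm_eq (enum T) (v :: rem v (enum T)).
  by apply: perm_to_rem; rewrite mem_enum.
by rewrite perm_cons.
Qed.

(** The orbit of [v] is all of [T], so the trajectory visits every vertex once and closes up. As it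
    determines [s] through [next], cutting at [v] is injective. *)
Lemma cyclic_perm_next (T : finType) (s : {perm T}) (v : T) :
  cyclic_perm s ->
  let t := traject s (s v) #|T|.-1 in
  perm_eq t (rem v (enum T)) /\ s =1 next (v :: t).
Proof.
move=> /eqP cyc t; have T_gt0 : (0 < #|T|)%N by apply/card_gt0P; exists v.
have orb : porbit s v = [set: T].
  by apply/set1P; rewrite -cyc; apply: imset_f.
have vtE : v :: t = traject s v #|porbit s v|.
  by rewrite orb cardsT -(prednK T_gt0).
have Uvt : uniq (v :: t) by rewrite vtE uniq_traject_porbit.
have vt_full x : x \in v :: t by rewrite vtE -porbit_traject orb inE.
have cycle_vt : fcycle s (v :: t).
  rewrite /= /t -[s v]/(iter 1 s v).
  have := iter_porbit s v; rewrite orb cardsT -{1}(prednK T_gt0) => sv.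
  have -> : rcons (traject s (s v) #|T|.-1) v = traject s (s v) #|T|.
    by rewrite -{2}(prednK T_gt0) trajectSr -iterSr sv.
  exact: fpath_traject.
split; last by move=> x; apply/eqP/(next_cycle cycle_vt).
rewrite perm_rem_enum; apply: uniq_perm => //; first exact: enum_uniq.
by move=> x; rewrite vt_full mem_enum.
Qed.

Lemma cyclic_perm_of_seq (T : finType) (v : T) (t : seq T) :
  perm_eq t (rem v (enum T)) ->
  exists2 s : {perm T}, cyclic_perm s & t = traject s (s v) #|T|.-1.
Proof.
rewrite perm_rem_enum => vt_enum.
have Uvt : uniq (v :: t) by rewrite (perm_uniq vt_enum) enum_uniq.
have szt : size t = #|T|.-1 by rewrite cardE -(perm_size vt_enum).
(* Close [v :: t] into a cycle and move each vertex to its successor. *)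
pose s := perm (can_inj (prev_next Uvt)).
have sE : s =1 next (v :: t) by move=> x; rewrite permE.
have path_t : fpath s v (rcons t v).
  by rewrite (eq_fpath sE); apply: (cycle_next Uvt).
have tE : t = traject s (s v) #|T|.-1.
  by move: path_t; rewrite rcons_path -szt => /andP[/fpathE].
exists s => //; rewrite /cyclic_perm.
have orb x : porbit s x = [set: T].
  have orbv : porbit s v = [set: T].
    apply/setP => y; rewrite inE.
    have: y \in v :: t by rewrite (perm_mem vt_enum) mem_enum.
    rewrite tE -[v :: _]/(traject s v #|T|.-1.+1) => /trajectP[i _ ->].
    by rewrite -permX mem_porbit.
  by rewrite -orbv; apply/eqP; rewrite eq_porbit_mem orbv inE.
apply/eqP/setP => A; rewrite inE; apply/imsetP/eqP => [[x _ ->]|->] //.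
by exists v.
Qed.

Lemma card_directed_hamiltonian_cycles (T : finType) (e : rel T) (v : T) :
  #|directed_hamiltonian_cycles e|
  = count (fun t => path e v (rcons t v)) (permutations (rem v (enum T))).
Proof.
pose f (s : {perm T}) := traject s (s v) #|T|.-1.
rewrite cardE -(size_map f) -size_filter; apply: perm_size; apply: uniq_perm.
- rewrite map_inj_in_uniq ?enum_uniq // => s1 s2.
  rewrite !mem_enum !inE => /andP[c1 _] /andP[c2 _] eq_f.
  have [_ n1] := cyclic_perm_next v c1; have [_ n2] := cyclic_perm_next v c2.
  by apply/permP => x; rewrite n1 n2 -!/(f _) eq_f.
- by rewrite filter_uniq ?permutations_uniq.
move=> t; rewrite mem_filter mem_permutations.
have edges (s : {perm T}) : cyclic_perm s ->
  [forall x, e x (s x)] = path e v (rcons (f s) v).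
  move=> cs; have [+ nE] := cyclic_perm_next v cs.
  rewrite perm_rem_enum => vf_enum.
  apply/forallP/idP => [es|pe x].
    apply: (@cycle_from_next _ e (v :: f s)) => [|x _]; last by rewrite -nE.
    by rewrite (perm_uniq vf_enum) enum_uniq.
  rewrite nE; apply: (next_cycle (p := v :: f s)) => //.
  by rewrite (perm_mem vf_enum) mem_enum.
apply/mapP/andP => [[s]|[pe /cyclic_perm_of_seq[s cs tE]]].
  rewrite mem_enum inE => /andP[cs es] ->.
  by rewrite -edges //; split=> //; case: (cyclic_perm_next v cs).
by exists s => //; rewrite mem_enum inE cs edges // /f -tE.
Qed.

Theorem proposition6p6 (m n : nat) (hm : (1 <= m)%N) (hn : (1 <= n)%N) :
  #|directed_hamiltonian_cycles (complete_multipartite m.+1 n)|%:R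
  = (-1) ^+ (n * m) * n`!%:R ^+ m * (n.-1)`!%:R * m`!%:R
    * \sum_(n <= k < (n * m).+1)
        (-1) ^+ k * 'C(k.-1, n.-1)%:R
        * bell_poly k m (fun i => 'C(n.-1, i.-1)%:R) :> rat.
Proof.
pose v : 'I_m.+1 * 'I_n := (ord0, Ordinal hn).
have v_enum : v \in enum {: 'I_m.+1 * 'I_n} by rewrite mem_enum.
(* Removing [v] leaves [n - 1] vertices in part 0, whence the single factor
   [(n.-1)]![beside]n[! ^ m]. *)
have cnt i : count (fun x : 'I_m.+1 * 'I_n => x.1 == i) (rem v (enum {: 'I_m.+1 * 'I_n}))
  = (n - (i == ord0))%N.
  rewrite count_rem v_enum [_ == i]eq_sym; congr (_ - _)%N.
  transitivity #|setX [set i] [set: 'I_n]|; last first.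
    by rewrite cardsX cards1 cardsT card_ord mul1n.
  rewrite enumT cardE /enum_mem size_filter; apply: eq_count => x.
  by rewrite /= !inE andbT.
rewrite (card_directed_hamiltonian_cycles _ v).
rewrite (@count_multipartite_paths _ _ fst v) ?rem_uniq ?enum_uniq //.
rewrite (eq_word_count _ cnt) /word_count eqxx subn1.
under eq_bigr => i _ do rewrite cnt.
rewrite (eq_bigr (fun=> run_poly n)); last by move=> i /negPf ->; rewrite subn0.
rewrite prodr_const cardC1 card_ord /= gap_form_deriv_run_poly_exp //.
rewrite (bigD1 ord0) //= subn1 (eq_bigr (fun=> n`!)); last first.
  by move=> i /negPf ->; rewrite subn0.
rewrite prod_nat_const cardC1 card_ord natrM natrX; ring.
Qed.
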